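(* Let $F$ be a field, $R=F[x_1,\dots,x_n]$, and let $I\subset R$ be a squarefree monomial ideal with $\mathrm{supp}(I)=\{x_1,\dots,x_n\}$ that is a quasi $f$-ideal of type $(a_{-1},a_0,a_1,\dots,a_d)$. Then: (1) The Hilbert series of $R/I$, in the variable $k$, is $$F(R/I,k)=\sum_{i=-1}^{d}\frac{f_i(\delta_{\mathcal F}(I))+a_i}{(1-k)^{i+1}}\,k^{i+1}.$$ (2) The Hilbert function of $R/I$ is given by $$H(R/I,k)=\sum_{i=0}^{d}\binom{k-1}{i}\left(f_i(\delta_{\mathcal F}(I))+a_i\right)\quad\text{for integers } k\ge 1,$$ and $H(R/I,0)=1$.
   Context: $R$ has the standard grading; the Hilbert function of $R/I$ is $H(R/I,k)=\dim_F (R/I)_k$ and the Hilbert series is the generating series $\sum_{m\ge 0}H(R/I,m)k^m$ in the variable $k$ (denoted $F(R/I,k)$, not to be confused with the field $F$). $G(I)$ is the minimal set of monomial generators of $I$, and $\mathrm{supp}(I)$ is the set of variables dividing at least one element of $G(I)$. Let $V=\{v_1,\dots,v_n\}$. The facet complex $\delta_{\mathcal F}(I)$ consists of all subsets of $V$ contained in $\{v_k : x_k\mid u\}$ for some $u\in G(I)$. The non-face (Stanley-Reisner) complex $\delta_{\mathcal N}(I)$ consists of all subsets $\{v_{i_1},\dots,v_{i_k}\}\subseteq V$ (distinct vertices) such that $x_{i_1}\cdots x_{i_k}\notin I$. The dimension of a set $W\subseteq V$ is $|W|-1$ (so $\dim\emptyset=-1$), the dimension of a complex is the maximum of the dimensions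 of its faces, and $f_i(\Delta)$ is the number of faces of $\Delta$ of dimension $i$. A squarefree monomial ideal $I$ is a quasi $f$-ideal of type $(a_{-1},a_0,\dots,a_d)\in\mathbb{Z}^{d+2}$ if $\dim\delta_{\mathcal F}(I)=\dim\delta_{\mathcal N}(I)=d$ and $f_i(\delta_{\mathcal N}(I))-f_i(\delta_{\mathcal F}(I))=a_i$ for all $-1\le i\le d$. *)

(* Defs.v *)
From HB Require Import structures.
From mathcomp Require Import all_boot all_order all_algebra.
From mathcomp Require Import boolp classical_sets functions.
From mathcomp Require Import mpoly.

Set Implicit Arguments.
Unset Strict Implicit.
Unset Printing Implicit Defensive.

Import Order.TTheory GRing.Theory Num.Theory.
Local Open Scope ring_scope.

Section SquarefreeMonomialIdeals.
Variables (F : fieldType) (n : nat).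
Implicit Types (I : {pred {mpoly F[n]}}) (G : {pred 'X_{1..n}}) (u : 'X_{1..n}).

(* I is the ideal of F[x_1, ..., x_n] generated by the monomials 'X_[u], u in G. *)
Definition generated_by G I : Prop :=
  forall p : {mpoly F[n]}, p \in I <->
    exists2 s : seq ({mpoly F[n]} * 'X_{1..n}),
      {in s, forall c, c.2 \in G} & p = \sum_(c <- s) c.1 * 'X_[c.2].

Definition squarefree u : Prop := forall i : 'I_n, (u i <= 1)%N.

Definition squarefree_monomial_ideal I : Prop :=
  exists2 G : {pred 'X_{1..n}}, {in G, forall u, squarefree u} & generated_by G I.

Definition minimal_monomial_generators I G : Prop :=
  generated_by G I /\
  forall G' : {pred 'X_{1..n}}, {subset G' <= G} -> generated_by G' I ->
    {subset G <= G'}.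

(* G(I); a monomial ideal has exactly one minimal set of monomial generators. *)
Definition mingens I : {pred 'X_{1..n}} :=
  fun u => `[< exists2 G : {pred 'X_{1..n}},
                 minimal_monomial_generators I G & u \in G >].

(* The indices of the variables dividing u; (_ <= _)%MM is divisibility. *)
Definition msupport u : {set 'I_n} := [set i | (U_(i) <= u)%MM].

Definition isupport I : {set 'I_n} :=
  [set i | `[< exists2 u, u \in mingens I & i \in msupport u >]].

(* The vertex v_i is identified with the index i of the variable x_i. *)
Definition facet_complex I : {set {set 'I_n}} :=
  [set W : {set 'I_n} | `[< exists2 u, u \in mingens I & W \subset msupport u >]].

Definition nonface_complex I : {set {set 'I_n}} :=
  [set W : {set 'I_n} | \prod_(i in W) 'X_i \notin I].

Implicit Type D : {set {set 'I_n}}.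

Definition face_dim (W : {set 'I_n}) : int := #|W|%:Z - 1.

(* dim D = d. The void complex, which lacks even the empty face, has no
   dimension. *)
Definition has_dim D (d : int) : Prop :=
  (exists2 W, W \in D & face_dim W = d) /\
  {in D, forall W : {set 'I_n}, face_dim W <= d}.

Definition fnum D (i : int) : nat := #|[set W in D | face_dim W == i]|.

(* The type (a_{-1}, a_0, ..., a_d) is the restriction of a to -1 <= i <= d;
   the other values of a play no role. *)
Definition quasi_f_ideal I (d : int) (a : int -> int) : Prop :=
  [/\ squarefree_monomial_ideal I,
      has_dim (facet_complex I) d,
      has_dim (nonface_complex I) d
    & forall i : int, -1 <= i <= d ->
        (fnum (nonface_complex I) i)%:Z - (fnum (facet_complex I) i)%:Z = a i].

(* The classes modulo I of the B j form an F-basis of (R/I)_k. *)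
Definition graded_quotient_basis I (k h : nat) (B : 'I_h -> {mpoly F[n]}) : Prop :=
  [/\ forall j, B j \is k.-homog,
      forall c : 'I_h -> F, \sum_j c j *: B j \in I -> forall j, c j = 0
    & forall p : {mpoly F[n]}, p \is k.-homog ->
        exists c : 'I_h -> F, p - \sum_j c j *: B j \in I].

(* H(R/I, k) = dim_F (R/I)_k. Since R_k is finite-dimensional, the default
   value of xget is not reached when I is an ideal. *)
Definition hilbert_function I (k : nat) : nat :=
  xget 0%N [set h | exists B : 'I_h -> {mpoly F[n]},
                      graded_quotient_basis I k B]%classic.

End SquarefreeMonomialIdeals.

(* Formal power series over int, as coefficient sequences. Addition is the
   pointwise one; the pointwise product on functions is not used. *)
Definition fps := nat -> int.

Definition fps_poly (p : {poly int}) : fps := fun m => p`_m.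

Definition fps_mul (f g : fps) : fps :=
  fun m => \sum_(j < m.+1) f j * g (m - j)%N.

(* The inverse of f in Z[[k]]; it is unique, and exists iff f 0 is a unit. *)
Definition fps_inv (f : fps) : fps :=
  xget (0 : nat -> int) [set g | fps_mul f g = fps_poly 1]%classic.

Definition fps_div (f g : fps) : fps := fps_mul f (fps_inv g).

Definition hilbert_series (F : fieldType) (n : nat) (I : {pred {mpoly F[n]}}) : fps :=
  fun m => (hilbert_function I m)%:Z.

(* The integers lo, lo + 1, ..., hi; empty if hi < lo. *)
Definition int_range (lo hi : int) : seq int :=
  [seq lo + j%:Z | j <- iota 0 (if lo <= hi then `|hi - lo|.+1 else 0)].

(* Main.v *)
Require Import Defs.
From HB Require Import structures.
From mathcomp Require Import all_boot all_order all_algebra.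
From mathcomp Require Import boolp classical_sets functions.
From mathcomp Require Import mpoly.

Set Implicit Arguments.
Unset Strict Implicit.
Unset Printing Implicit Defensive.

Import Order.TTheory GRing.Theory Num.Theory.
Local Open Scope ring_scope.

(** By the definition of the type, f_i of the facet complex plus a_i is f_i of
    the non-face complex for -1 <= i <= d, so both formulas are statements about
    the non-face complex N alone; they are Stanley's formulas for the face ring.

    The ideal I is generated by monomials, so a polynomial lies in I exactly
    when each of its monomials does ([monomial_ideal_msupp]).  Since the
    generators are squarefree, membership of a monomial only depends on the set
    of variables occurring in it: it lies outside I exactly when this set is a
    face of N ([squarefree_monomial_carrier]).  Hence the monomials of degree k
    carried by a face of N form a basis of the degree k part of R/I, and the
    Hilbert function counts them.

    Sorting these monomials by the face W that carries them leaves, for each W,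
    the number of ways to write k as an ordered sum of |W| positive integers
    ([hilbert_function_nonface]).  This number is the binomial coefficient
    C(k - 1, |W| - 1) when k and |W| are positive, which gives (2).  As a
    function of k it is the coefficient sequence of (X / (1 - X))^|W|, because
    Pascal's rule says that multiplying by 1 - X turns the sequence for w + 1
    into the shifted sequence for w ([compositions_fps]); this gives (1). *)

(** * Formal power series *)

Definition fps_trunc (N : nat) (f : fps) : {poly int} := \poly_(i < N) f i.

(** A coefficient of a product only sees finitely many coefficients of the
    factors, so the ring laws of power series can be read off those of the
    truncations, which are polynomials. *)
Lemma fps_mul_trunc (N m : nat) (f g : fps) :
  (m < N)%N -> fps_mul f g m = (fps_trunc N f * fps_trunc N g)`_m.
Proof.
move=> ltmN; rewrite coefM; apply: eq_bigr => j _.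
have lejm : (j <= m)%N by rewrite -ltnS.
by rewrite !coef_poly !(leq_ltn_trans _ ltmN) ?leq_subr.
Qed.

Lemma fps_mul_polyE (p : {poly int}) (f : fps) (m : nat) :
  fps_mul (fps_poly p) f m = (p * fps_trunc m.+1 f)`_m.
Proof.
by rewrite coefM; apply: eq_bigr => j _; rewrite coef_poly ltnS leq_subr.
Qed.

Lemma fps_mulC (f g : fps) : fps_mul f g = fps_mul g f.
Proof.
by apply/funext => m; rewrite !(@fps_mul_trunc m.+1) // mulrC.
Qed.

Lemma fps_mulA (f g h : fps) :
  fps_mul f (fps_mul g h) = fps_mul (fps_mul f g) h.
Proof.
apply/funext => m; rewrite !(@fps_mul_trunc m.+1) //.
have lt_ord (j : 'I_m.+1) : (m - j < m.+1)%N by rewrite ltnS leq_subr.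
transitivity ((fps_trunc m.+1 f * (fps_trunc m.+1 g * fps_trunc m.+1 h))`_m).
  rewrite ![in LHS]coefM [in RHS]coefM; apply: eq_bigr => j _; congr (_ * _).
  by rewrite coef_poly lt_ord; apply: fps_mul_trunc.
rewrite mulrA ![in LHS]coefM [in RHS]coefM.
apply: eq_bigr => j _; congr (_ * _).
by rewrite [in RHS]coef_poly ltn_ord -fps_mul_trunc.
Qed.

Lemma fps_mul1 (f : fps) : fps_mul (fps_poly 1) f = f.
Proof. by apply/funext => m; rewrite fps_mul_polyE mul1r coef_poly ltnSn. Qed.

Lemma fps_polyM (p q : {poly int}) :
  fps_poly (p * q) = fps_mul (fps_poly p) (fps_poly q).
Proof. by apply/funext => m; rewrite /fps_poly coefM. Qed.

(** The value chosen by [fps_inv] is unspecified, so it can only be used through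
    this equation, once some inverse [g] is known to exist. *)
Lemma fps_mul_invr (f g : fps) :
  fps_mul f g = fps_poly 1 -> fps_mul f (fps_inv f) = fps_poly 1.
Proof.
move=> fg1; pose inverses := [set u | fps_mul f u = fps_poly 1]%classic.
by have /(xgetPex (0 : nat -> int)) : exists u, inverses u by exists g.
Qed.

(** Cancelling [g] computes a quotient from a product, without any formula for
    the coefficients of the inverse of [g]. *)
Lemma fps_divP (f g h u : fps) :
  fps_mul g u = fps_poly 1 -> fps_mul g h = f -> fps_div f g = h.
Proof.
move=> gu1 <-; rewrite /fps_div (fps_mulC g) -fps_mulA (fps_mul_invr gu1).
by rewrite fps_mulC fps_mul1.
Qed.

Lemma fps_mul_1subX (f : fps) (m : nat) :
  fps_mul (fps_poly (1 - 'X)) f m = f m - (if m is k.+1 then f k else 0).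
Proof.
rewrite fps_mul_polyE mulrBl mul1r coefB coefXM !coef_poly ltnSn.
by case: m => [|m] //=; rewrite leqnSn.
Qed.

Lemma fps_mul_X (f : fps) (m : nat) :
  fps_mul (fps_poly 'X) f m = if m is k.+1 then f k else 0.
Proof.
by rewrite fps_mul_polyE coefXM; case: m => [|m] //=; rewrite coef_poly leqnSn.
Qed.

Lemma fps_1subXn_unit (w : nat) :
  exists u : fps, fps_mul (fps_poly ((1 - 'X) ^+ w)) u = fps_poly 1.
Proof.
elim: w => [|w [u wu1]]; first by exists (fps_poly 1); rewrite fps_mul1.
exists (fps_mul u (fun=> 1)); rewrite exprSr fps_polyM fps_mulC.
rewrite -fps_mulA [fps_mul (fun=> 1) _]fps_mulC -fps_mulA.
(* The constant sequence 1 is the geometric series, the inverse of 1 - X. *)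
have -> : fps_mul (fps_poly (1 - 'X)) (fun=> 1) = fps_poly 1.
  apply/funext => m; rewrite fps_mul_1subX /fps_poly coef1.
  by case: m => [|m]; rewrite ?subr0 ?subrr.
by rewrite fps_mulA fps_mulC fps_mul1 fps_mulC.
Qed.

(** * Counting compositions *)

(** The number of ways to write [m] as an ordered sum of [w] positive integers.
    The closed form is taken as the definition because it is the one of the
    Hilbert function formula; that it counts is [coef_compositions]. *)
Definition compositions (w m : nat) : nat :=
  match w, m with
  | 0, m => m == 0
  | w'.+1, 0 => 0
  | w'.+1, m'.+1 => 'C(m', w')
  end.

(** Pascal's rule; combinatorially, a last part larger than 1 can be decreased,
    and a last part equal to 1 can be removed. *)
Lemma compositionsSS (w m : nat) :
  compositions w.+1 m.+1 = (compositions w.+1 m + compositions w m)%N.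
Proof. by case: w m => [|w] [|m] //=; rewrite ?bin0 // binS. Qed.

Lemma compositionsS (w m : nat) :
  compositions w.+1 m = (\sum_(j < m) compositions w j)%N.
Proof.
by elim: m => [|m IHm]; rewrite ?big_ord0 // big_ord_recr compositionsSS IHm.
Qed.

(** The generating series of the compositions into w parts is (X / (1 - X))^w:
    by Pascal's rule, multiplying by 1 - X turns the sequence for w + 1 into the
    sequence for w shifted by one. *)
Lemma compositions_fps (w : nat) :
  fps_mul (fps_poly ((1 - 'X) ^+ w)) (fun m => (compositions w m)%:Z) =
  fps_poly 'X^w.
Proof.
elim: w => [|w IHw].
  by rewrite expr0 fps_mul1; apply/funext => m; rewrite /fps_poly coef1 -natz.
have step : fps_mul (fps_poly (1 - 'X)) (fun m => (compositions w.+1 m)%:Z) =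
            fps_mul (fps_poly 'X) (fun m => (compositions w m)%:Z).
  apply/funext => m; rewrite fps_mul_1subX fps_mul_X.
  case: m => [|m]; first by rewrite subr0.
  by rewrite compositionsSS PoszD addrAC subrr add0r.
rewrite exprSr fps_polyM -fps_mulA step exprS fps_polyM -IHw !fps_mulA.
by rewrite (fps_mulC (fps_poly 'X)).
Qed.

Lemma face_series (c : int) (w m : nat) :
  fps_mul (fps_div (fps_poly c%:P) (fps_poly ((1 - 'X) ^+ w))) (fps_poly 'X^w) m
  = c * (compositions w m)%:Z.
Proof.
have [u wu1] := fps_1subXn_unit w.
rewrite /fps_div -fps_mulA [fps_mul (fps_inv _) _]fps_mulC -/(fps_div _ _).
rewrite (fps_divP wu1 (compositions_fps w)) fps_mul_polyE coefCM.
by rewrite coef_poly ltnSn.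
Qed.

(** Expanding the power picks one exponent between 1 and [k] in each factor.  In
    degrees up to [k] the upper bound [k] on the exponents excludes nothing. *)
Lemma coef_compositions (k w m : nat) : (m <= k)%N ->
  ((\sum_(j < k.+1 | j != ord0) 'X^j) ^+ w : {poly int})`_m =
  (compositions w m)%:Z.
Proof.
elim: w m => [|w IHw] m lemk; first by rewrite expr0 coef1 -natz.
have coefP j : (j <= k)%N ->
    (\sum_(i < k.+1 | i != ord0) 'X^i : {poly int})`_j = (0 < j)%N%:R.
  move=> lejk; rewrite coef_sum.
  case: (posnP j) => [-> | j_gt0].
    by rewrite big1 // => i; rewrite -val_eqE coefXn eq_sym => /negPf ->.
  have ltjk : (j < k.+1)%N by [].
  rewrite (bigD1 (Ordinal ltjk)) /=; last by rewrite -val_eqE -lt0n.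
  rewrite coefXn eqxx big1 ?addr0 // => i /andP[_ ne_ij].
  by move: ne_ij; rewrite -val_eqE coefXn eq_sym => /negPf ->.
(* The first factor contributes an exponent j + 1, which leaves the degree
   m - (j + 1) to the w other ones; reversing j yields the sum of
   [compositionsS]. *)
rewrite exprS coefM big_ord_recl coefP // mul0r add0r compositionsS.
rewrite -natz natr_sum [RHS](reindex_inj rev_ord_inj).
apply: eq_bigr => j _.
rewrite lift0 coefP ?(leq_trans _ lemk) // mul1r IHw ?natz //.
by rewrite (leq_trans (leq_subr _ _)).
Qed.

(** * Membership in a monomial ideal *)

Section MonomialIdeal.
Variables (F : fieldType) (n : nat).
Implicit Types (I : {pred {mpoly F[n]}}) (G : {pred 'X_{1..n}}).
Implicit Types (p q : {mpoly F[n]}) (u : 'X_{1..n}).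

(** Multiplying by 'X_[g] only produces monomials divisible by g, and conversely
    each term of p can absorb a generator dividing its monomial. *)
Lemma monomial_idealP I G p : generated_by G I ->
  p \in I <-> {in msupp p, forall u, exists2 g, g \in G & (g <= u)%MM}.
Proof.
move=> genI; split=> [/genI[s sG ->] u | div_p].
  move/msupp_sum_le; case/flattenP => _ /mapP[c cs ->].
  rewrite (perm_mem (msuppMX _ _)); case/mapP => v _ ->; exists c.2.
    by apply: sG; move: cs; rewrite filter_predT.
  by rewrite lem_addr.
apply/genI; move: div_p; rewrite {2}[p]mpolyE.
elim: (msupp p) => [|u r IHr] div_p; first by exists [::]; rewrite ?big_nil.
have [|s sG def_r] := IHr.
  by move=> v vr; apply: div_p; rewrite inE vr orbT.
have [g gG leg] := div_p u (mem_head _ _).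
exists ((p@_u *: 'X_[u - g], g) :: s); last first.
  by rewrite !big_cons /= def_r -scalerAl -mpolyXD submK.
by move=> c; rewrite inE => /predU1P[-> // | /sG].
Qed.

Lemma monomial_in_idealP I G u : generated_by G I ->
  'X_[u] \in I <-> exists2 g, g \in G & (g <= u)%MM.
Proof.
move=> genI; rewrite (monomial_idealP _ genI) msuppX; split.
  by apply; rewrite mem_head.
by move=> ex_g v; rewrite inE => /eqP ->.
Qed.

Lemma monomial_ideal_msupp I G p : generated_by G I ->
  p \in I <-> {in msupp p, forall u, 'X_[u] \in I}.
Proof.
move=> genI; rewrite (monomial_idealP _ genI).
by split=> div_p u /div_p/(monomial_in_idealP _ genI).
Qed.

Lemma prod_mpolyXU (W : {set 'I_n}) :
  \prod_(i in W) 'X_i = 'X_[F, \sum_(i in W) U_(i)] :> {mpoly F[n]}.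
Proof. exact/esym/(big_morph _ (@mpolyXD n F) (mpolyX0 n F)). Qed.

Definition mcarrier u : {set 'I_n} := [set i | u i != 0%N].

(** A squarefree monomial divides u exactly when it divides the product of the
    variables occurring in u. *)
Lemma squarefree_monomial_carrier I u : squarefree_monomial_ideal I ->
  ('X_[u] \in I) = (mcarrier u \notin nonface_complex I).
Proof.
case=> G sqfG genI; rewrite inE negbK prod_mpolyXU.
apply/idP/idP => /(monomial_in_idealP _ genI)[g gG /mnm_lepP leg];
  apply/(monomial_in_idealP _ genI); exists g => //; apply/mnm_lepP => i.
- rewrite mnm_sumE.
  rewrite (eq_bigr (fun j => (j == i) : nat)) => [|j _]; last by rewrite mnm1E.
  have := leg i; case: (boolP (i \in mcarrier u)) => [iu _ | ].
    rewrite (bigD1 i) //= eqxx.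
    exact: leq_trans (sqfG _ gG i) (leq_addr _ _).
  by rewrite inE negbK => /eqP -> ; rewrite leqn0 => /eqP ->.
have := leg i; rewrite mnm_sumE.
case: (posnP (u i)) => [ui0 | ui_gt0 _]; last first.
  exact: leq_trans (sqfG _ gG i) ui_gt0.
rewrite big1 ?ui0 // => j; rewrite inE mnm1E; have [-> | //] := eqVneq j i.
by rewrite ui0.
Qed.

Lemma set0_in_nonface I W : squarefree_monomial_ideal I ->
  W \in nonface_complex I -> finset.set0 \in nonface_complex I.
Proof.
case=> G _ genI; rewrite !inE !prod_mpolyXU; apply: contra.
case/(monomial_in_idealP _ genI) => g gG leg.
apply/(monomial_in_idealP _ genI); exists g => //.
apply: lepm_trans leg _; rewrite big_set0.
by apply/mnm_lepP => i; rewrite mnm0E.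
Qed.

(** * The Hilbert function as the size of any basis *)

Lemma mem_idealD I G p q : generated_by G I ->
  p \in I -> q \in I -> p + q \in I.
Proof.
move=> genI /(monomial_ideal_msupp _ genI) Ip /(monomial_ideal_msupp _ genI) Iq.
apply/(monomial_ideal_msupp _ genI) => u /msuppD_le.
by rewrite mem_cat => /orP[/Ip | /Iq].
Qed.

Lemma mem_idealZ I G (c : F) p : generated_by G I -> p \in I -> c *: p \in I.
Proof.
move=> genI /(monomial_ideal_msupp _ genI) Ip.
by apply/(monomial_ideal_msupp _ genI) => u /msuppZ_le /Ip.
Qed.

Lemma mem_ideal_sum I G (J : finType) (B : J -> {mpoly F[n]}) :
  generated_by G I -> (forall j, B j \in I) -> \sum_j B j \in I.
Proof.
move=> genI IB; apply: (big_ind (fun p => p \in I)) => // [|p q].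
  by apply/(monomial_ideal_msupp _ genI) => u; rewrite mcoeff_msupp mcoeff0 eqxx.
exact: mem_idealD.
Qed.

(** Modulo I, the rows of a matrix A express the independent family B in B'.  A
    row vector v with v A = 0 would give a linear relation between the members
    of B, so A has independent rows, and at most as many of them as columns. *)
Lemma graded_quotient_basis_leq I G k h h'
    (B : 'I_h -> {mpoly F[n]}) (B' : 'I_h' -> {mpoly F[n]}) :
  generated_by G I -> graded_quotient_basis I k B ->
  graded_quotient_basis I k B' -> (h <= h')%N.
Proof.
move=> genI [homB freeB _] [_ _ spanB'].
have [M MP] := choice (fun j => spanB' _ (homB j)).
pose A : 'M[F]_(h, h') := \matrix_(j, i) M j i.
suff: row_free A.
  by rewrite -row_leq_rank => /leq_trans; apply; exact: rank_leq_col.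
apply: inj_row_free => v vA0; apply/rowP => j; rewrite mxE.
apply: (freeB (fun j => v 0 j)).
have -> : \sum_j v 0 j *: B j =
          \sum_j v 0 j *: (B j - \sum_i M j i *: B' i).
  under [RHS]eq_bigr do rewrite scalerBr.
  rewrite sumrB [X in _ - X](_ : _ = 0) ?subr0 //.
  under eq_bigr do rewrite scaler_sumr.
  rewrite exchange_big big1 // => i _; under eq_bigr do rewrite scalerA.
  rewrite -scaler_suml; have := congr1 (fun w : 'rV_h' => w 0 i) vA0.
  by rewrite !mxE; under eq_bigr do rewrite mxE; move=> ->; rewrite scale0r.
by apply: (mem_ideal_sum genI) => j'; apply: (mem_idealZ _ genI).
Qed.

Lemma hilbert_functionE I G k h (B : 'I_h -> {mpoly F[n]}) :
  generated_by G I -> graded_quotient_basis I k B -> hilbert_function I k = h.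
Proof.
move=> genI basB; apply: xget_unique; first by exists B.
move=> h' [B' basB']; apply/eqP; rewrite eqn_leq.
rewrite (graded_quotient_basis_leq genI basB' basB).
exact: graded_quotient_basis_leq genI basB basB'.
Qed.

End MonomialIdeal.

(** * Monomials of a given degree *)

Section ExponentVectors.
Variables (n k : nat).
Implicit Types (f : {ffun 'I_n -> 'I_k.+1}).

Definition fcarrier f : {set 'I_n} := [set i | f i != ord0].

(** The generating polynomial of the exponent vectors with carrier W is a
    product over the variables: a nonzero exponent is chosen for each variable
    in W, and the exponent 0 for the others. *)
Lemma card_exponents (W : {set 'I_n}) :
  #|[set f : {ffun 'I_n -> 'I_k.+1} |
      (\sum_i f i == k)%N & fcarrier f == W]| = compositions #|W| k.
Proof.
pose P : {poly int} := \sum_(j < k.+1 | j != ord0) 'X^j.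
have expandP : P ^+ #|W| =
    \sum_(f : {ffun 'I_n -> 'I_k.+1} | fcarrier f == W) 'X^(\sum_i f i)%N.
  have -> : P ^+ #|W| = \prod_(i : 'I_n) \sum_(j < k.+1)
      if (j != ord0) == (i \in W) then 'X^j else 0.
    rewrite -prodr_const big_mkcond; apply: eq_bigr => i _; rewrite -big_mkcond.
    case: (i \in W) => /=; first by apply: eq_bigl => j; rewrite eqb_id.
    rewrite (eq_bigl (pred1 ord0)) ?big_pred1_eq // => j.
    by rewrite /= eqbF_neg negbK.
  rewrite bigA_distr_bigA [RHS]big_mkcond; apply: eq_bigr => f _.
  case: eqP => [<- | neqW].
    by rewrite expr_sum; apply: eq_bigr => i _; rewrite inE eqxx.
  case: (pickP [pred i | (f i != ord0) != (i \in W)]) => [i /negPf ne_i | eqW].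
    by rewrite (bigD1 i) //= ne_i mul0r.
  by case: neqW; apply/setP => i; have /negbFE/eqP := eqW i; rewrite inE.
apply/eqP; rewrite -eqz_nat -(coef_compositions _ (leqnn k)) -/P expandP.
rewrite coef_sum -sum1dep_card -natz natr_sum big_mkcondl; apply/eqP.
by apply: eq_bigr => f _; rewrite coefXn eq_sym; case: eqP.
Qed.

(** In degree [k] all exponents are at most [k], so the monomials can be indexed
    by a finite type. *)
Definition mnm_of_exponents f : 'X_{1..n} := [multinom (f i : nat) | i < n].

Lemma mnm_of_exponents_inj : injective mnm_of_exponents.
Proof.
move=> f g /mnmP eq_fg; apply/ffunP => i; apply: val_inj.
by have := eq_fg i; rewrite !mnmE.
Qed.

Lemma mnm_of_exponents_onto (u : 'X_{1..n}) :
  mdeg u = k -> exists f, mnm_of_exponents f = u.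
Proof.
move=> degu; exists [ffun i => inord (u i)]; apply/mnmP => i.
by rewrite mnmE ffunE inordK // ltnS -degu mdegE (bigD1 i) //= leq_addr.
Qed.

Lemma mdeg_mnm_of_exponents f : mdeg (mnm_of_exponents f) = (\sum_i f i)%N.
Proof. by rewrite mdegE; apply: eq_bigr => i _; rewrite mnmE. Qed.

Lemma mcarrier_mnm_of_exponents f : mcarrier (mnm_of_exponents f) = fcarrier f.
Proof. by apply/setP => i; rewrite !inE mnmE. Qed.

End ExponentVectors.

(** Because I is spanned by the monomials that it contains, the remaining ones
    are independent modulo I, and every polynomial is congruent to the sum of
    its terms outside I. *)
Lemma monomial_graded_quotient_basis (F : fieldType) (n k : nat)
    (I : {pred {mpoly F[n]}}) (S : {set {ffun 'I_n -> 'I_k.+1}}) :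
  squarefree_monomial_ideal I ->
  S = [set f : {ffun 'I_n -> 'I_k.+1} |
         (\sum_i f i == k)%N & fcarrier f \in nonface_complex I] ->
  graded_quotient_basis I k
    (fun j : 'I_#|S| => 'X_[mnm_of_exponents (enum_val j)]).
Proof.
move=> sqfI defS; have [G _ genI] := sqfI.
have XI f :
    ('X_[mnm_of_exponents f] \in I) = (fcarrier f \notin nonface_complex I).
  by rewrite (squarefree_monomial_carrier _ sqfI) mcarrier_mnm_of_exponents.
have coef_sumB (c : 'I_#|S| -> F) j :
    (\sum_i c i *: 'X_[mnm_of_exponents (enum_val i)])
      @_(mnm_of_exponents (enum_val j)) = c j.
  rewrite raddf_sum (bigD1 j) //= mcoeffZ mcoeffX eqxx mulr1.
  rewrite big1 ?addr0 // => i.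
  rewrite mcoeffZ mcoeffX (inj_eq (@mnm_of_exponents_inj _ _)).
  by rewrite (inj_eq enum_val_inj) => /negPf ->; rewrite mulr0.
have coef_out (c : 'I_#|S| -> F) u :
    (forall j : 'I_#|S|, mnm_of_exponents (enum_val j) != u) ->
    (\sum_i c i *: 'X_[mnm_of_exponents (enum_val i)])@_u = 0.
  move=> out; rewrite raddf_sum big1 // => j _ /=.
  by rewrite mcoeffZ mcoeffX (negPf (out j)) mulr0.
have degS (j : 'I_#|S|) : mdeg (mnm_of_exponents (enum_val j)) = k.
  have := enum_valP j; rewrite {2}defS inE => /andP[/eqP degj _].
  by rewrite mdeg_mnm_of_exponents.
have notXI (j : 'I_#|S|) : 'X_[mnm_of_exponents (enum_val j)] \notin I.
  by have := enum_valP j; rewrite {2}defS inE XI negbK => /andP[].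
split=> [j | c cI j | p homp]; first by rewrite dhomogX /= degS.
  apply: contraNeq (notXI j) => cj_neq0.
  have /(monomial_ideal_msupp _ genI) := cI; apply.
  by rewrite mcoeff_msupp coef_sumB.
exists (fun j => p@_(mnm_of_exponents (enum_val j))).
apply/(monomial_ideal_msupp _ genI) => u; apply: contraLR => uI.
rewrite mcoeff_msupp mcoeffB negbK.
case: (eqVneq (mdeg u) k) => [degu | degu]; last first.
  rewrite (dhomog_nemf_coeff homp degu) coef_out ?subr0 // => j.
  by apply: contraNneq degu => <-; rewrite degS.
have [f def_u] := mnm_of_exponents_onto degu.
have fS : f \in S.
  rewrite defS inE -mdeg_mnm_of_exponents def_u degu eqxx.
  by move: uI; rewrite -def_u XI negbK.
by rewrite -def_u -(enum_rankK_in fS fS) coef_sumB subrr.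
Qed.

Lemma hilbert_function_nonface (F : fieldType) (n k : nat)
    (I : {pred {mpoly F[n]}}) :
  squarefree_monomial_ideal I ->
  hilbert_function I k = (\sum_(W in nonface_complex I) compositions #|W| k)%N.
Proof.
move=> sqfI; have [G _ genI] := sqfI.
have basB := monomial_graded_quotient_basis (k := k) sqfI erefl.
rewrite (hilbert_functionE genI basB).
rewrite -sum1dep_card.
rewrite (partition_big (@fcarrier n k) (mem (nonface_complex I))) /=.
  apply: eq_bigr => W NW; rewrite -card_exponents -sum1dep_card.
  apply: eq_bigl => f.
  case: (eqVneq (fcarrier f) W) => [-> | _]; rewrite ?andbF //.
  by rewrite andbT NW !andbT.
by move=> f /andP[].
Qed.

(** * Grouping the faces by dimension *)

Lemma int_rangeE (lo : int) (m : nat) :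
  int_range lo (lo + m%:Z - 1) = [seq lo + j%:Z | j <- index_iota 0 m].
Proof.
rewrite /int_range /index_iota subn0; congr [seq _ | _ <- iota 0 _].
rewrite -addrA lerDl addrAC subrr add0r; case: m => [|m] //.
by have -> : m.+1%:Z - 1 = m%:Z by rewrite -addn1 PoszD addrK.
Qed.

Lemma face_dim_eq (n : nat) (W : {set 'I_n}) (w : nat) :
  (face_dim W == -1 + w%:Z) = (#|W| == w).
Proof. by rewrite /face_dim addrC (inj_eq (addrI _)). Qed.

Lemma sum_compositions_by_dim (n e m : nat) (D : {set {set 'I_n}}) :
  has_dim D (-1 + e%:Z) ->
  (\sum_(W in D) compositions #|W| m)%N =
  (\sum_(w < e.+1) fnum D (-1 + w%:Z) * compositions w m)%N.
Proof.
case=> _ leD.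
have leDe W : W \in D -> (#|W| <= e)%N.
  by move/leD; rewrite /face_dim addrC lerD2l.
rewrite (partition_big (fun W : {set 'I_n} => inord #|W| : 'I_e.+1) predT) //=.
apply: eq_bigr => w _; rewrite -sum_nat_const; apply: eq_big => W.
  rewrite inE face_dim_eq; apply: andb_id2l => /leDe leWe.
  by rewrite -val_eqE /= inordK.
by case/andP=> /leDe leWe /eqP <-; rewrite inordK.
Qed.

(** * The Hilbert series and function of a quasi f-ideal *)

Theorem theorem3p7 (F : fieldType) (n : nat) (I : {pred {mpoly F[n]}})
    (d : int) (a : int -> int)
    (hI : squarefree_monomial_ideal I)
    (hsupp : isupport I = [set: 'I_n])
    (hq : quasi_f_ideal I d a) :
  (* (1) *)
  hilbert_series I =
    (\sum_(i <- int_range (-1) d)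
       fps_mul
         (fps_div (fps_poly ((fnum (facet_complex I) i)%:Z + a i)%:P)
                  (fps_poly ((1 - 'X) ^+ `|(i + 1)%R|%N)))
         (fps_poly 'X^(`|(i + 1)%R|%N)) : nat -> int) /\
  (* (2) *)
  (forall k : nat, (1 <= k)%N ->
     (hilbert_function I k)%:Z =
       \sum_(i <- int_range 0 d)
         ('C(k.-1, `|i|%N))%:Z * ((fnum (facet_complex I) i)%:Z + a i)) /\
  hilbert_function I 0 = 1%N.
Proof.
have [_ _ dimN type_a] := hq.
(* The dimension is attained, hence d >= -1; below, e = d + 1 and the faces are
   indexed by their cardinality w = i + 1. *)
have [[W NW dimW] _] := dimN.
have def_d : d = -1 + #|W|%:Z by rewrite -dimW /face_dim addrC.
move: #|W| def_d => e {dimW}def_d; subst d.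
have fnumE (w : nat) : (w <= e)%N ->
    (fnum (facet_complex I) (-1 + w%:Z))%:Z + a (-1 + w%:Z) =
    (fnum (nonface_complex I) (-1 + w%:Z))%:Z.
  move=> lewe; rewrite -(type_a (-1 + w%:Z)); last by rewrite lerDl lerD2l.
  by rewrite addrC subrK.
have absE (w : nat) : `|((-1 + w%:Z) + 1)%R|%N = w by rewrite addrC addNKr.
have hilbE m : (hilbert_function I m)%:Z =
    \sum_(w < e.+1)
      (fnum (nonface_complex I) (-1 + w%:Z))%:Z * (compositions w m)%:Z.
  rewrite (hilbert_function_nonface _ hI) (sum_compositions_by_dim _ dimN).
  by rewrite -natz natr_sum; apply: eq_bigr => w _; rewrite natz PoszM.
split; last split.
- apply/funext => m; rewrite /hilbert_series hilbE.
  have -> : -1 + e%:Z = -1 + e.+1%:Z - 1 by rewrite -addn1 PoszD addrA addrK.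
  rewrite int_rangeE big_map big_mkord fct_sumE.
  by apply: eq_bigr => w _; rewrite absE face_series fnumE // -ltnS.
- (* The empty face, w = 0, contributes nothing in positive degree. *)
  case=> [//|k] _; rewrite hilbE big_ord_recl mulr0 add0r.
  have -> : -1 + e%:Z = 0 + e%:Z - 1 by rewrite add0r addrC.
  rewrite int_rangeE big_map big_mkord.
  apply: eq_bigr => w _; rewrite add0r absz_nat.
  have -> : w%:Z = -1 + (lift ord0 w)%:Z by rewrite lift0 -add1n PoszD addKr.
  by rewrite mulrC fnumE // lift0.
(* In degree 0 only the empty face contributes, and its contribution is 1. *)
rewrite (hilbert_function_nonface _ hI).
have N0 := set0_in_nonface hI NW.
rewrite (bigD1 finset.set0) //= cards0 big1 // => V /andP[_].
by rewrite -card_gt0; case: #|V|.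
Qed.
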